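(* In the setting described in the context, choose an initial point $x_0$, target accuracy $0<\epsilon<\min\{f(x_0)-f^*,2\mathcal{R}_{LP^{-1}}^2(x_0)\}$, confidence $0<\rho<1$, and $k$ satisfying either $$k\geq\frac{2\mathcal{R}^2_{LP^{-1}}(x_0)}{\epsilon}\left(1+\log\frac1\rho\right)+2-\frac{2\mathcal{R}^2_{LP^{-1}}(x_0)}{f(x_0)-f^*}$$ or $$k\geq\frac{2\mathcal{R}^2_{LP^{-1}}(x_0)}{\epsilon}\left(1+\log\frac1\rho\right)-2.$$ If $x_k$ is the random point generated by RCDS$(p,x_0)$ applied to the convex function $f$, then $\mathbf{P}(f(x_k)-f^*\leq\epsilon)\geq1-\rho$.
   Context: Let $U\in\mathbf{R}^{N\times N}$ be a column permutation of the $N\times N$ identity matrix, partitioned as $U=[U_1,\dots,U_n]$ with $U_i\in\mathbf{R}^{N\times N_i}$, $\sum_iN_i=N$; for $x\in\mathbf{R}^N$ write $x^{(i)}=U_i^Tx$, so $x=\sum_iU_ix^{(i)}$. Each $\mathbf{R}^{N_i}$ carries an arbitrary norm $\|\cdot\|_{(i)}$ with dual norm $\|s\|_{(i)}^*=\max_{\|t\|_{(i)}=1}\langle s,t\rangle$. Let $f:\mathbf{R}^N\to\mathbf{R}$ be convex and differentiable with $\|\nabla_if(x+U_it)-\nabla_if(x)\|_{(i)}^*\leq L_i\|t\|_{(i)}$ for all $x\in\mathbf{R}^N$, $t\in\mathbf{R}^{N_i}$, $i$, where $L_i>0$ and $\nabla_if(x)=U_i^T\nabla f(x)$; assume $f$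 attains its minimum $f^*$, with set of minimizers $X^*$. Let $p=(p_1,\dots,p_n)$ be a probability vector with all $p_i>0$, $L=\mathrm{Diag}(L_1,\dots,L_n)$, $P=\mathrm{Diag}(p_1,\dots,p_n)$, and for $W=\mathrm{Diag}(w_1,\dots,w_n)$ with $w_i>0$ let $\|x\|_W=(\sum_iw_i\|x^{(i)}\|_{(i)}^2)^{1/2}$; in particular $\|x\|_{LP^{-1}}=(\sum_i\frac{L_i}{p_i}\|x^{(i)}\|_{(i)}^2)^{1/2}$. Let $\mathcal{R}_W(x)=\max_y\max_{x^*\in X^*}\{\|y-x^*\|_W: f(y)\leq f(x)\}$, and $\mathcal{R}^2_W$ its square. For $s\in\mathbf{R}^{N_i}$, $s^\#$ denotes an optimal solution of $\min_{t\in\mathbf{R}^{N_i}}\{-\langle s,t\rangle+\frac12\|t\|_{(i)}^2\}$. Algorithm RCDS$(p,x_0)$: for $k=0,1,2,\dots$, choose $i\in\{1,\dots,n\}$ with probability $p_i$ (independently), and set $x_{k+1}=x_k-\frac1{L_i}U_i(\nabla_if(x_k))^\#$. *)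

(* Defs.v *)
From HB Require Import structures.
From mathcomp Require Import all_boot all_order all_algebra.
From mathcomp Require Import all_classical all_reals all_analysis.
Set Implicit Arguments. Unset Strict Implicit. Unset Printing Implicit Defensive.
Import Order.TTheory GRing.Theory Num.Theory.
Import numFieldNormedType.Exports.
Local Open Scope classical_set_scope.
Local Open Scope ring_scope.

Section RCDS.
Variable R : realType.

Definition inner m (s t : 'cV[R]_m) : R := (s^T *m t) 0 0.

Definition is_norm m (nu : 'cV[R]_m -> R) : Prop :=
  [/\ forall x, 0 <= nu x,
      forall x, nu x = 0 -> x = 0,
      forall (a : R) x, nu (a *: x) = `|a| * nu x
    & forall x y, nu (x + y) <= nu x + nu y].

Definition dual_norm m (nu : 'cV[R]_m -> R) (s : 'cV[R]_m) : R :=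
  sup [set r | exists t, nu t = 1 /\ r = inner s t].

Definition convex_fun N (f : 'cV[R]_N -> R) : Prop :=
  forall (x y : 'cV[R]_N) (t : R), 0 <= t <= 1 ->
    f (t *: x + (1 - t) *: y) <= t * f x + (1 - t) * f y.

Definition grad N (f : 'cV[R]_N -> R^o) (x : 'cV[R]_N) : 'cV[R]_N :=
  \col_(j < N) ('d f x (delta_mx j 0 : 'cV[R]_N)).

Definition wnorm n (Ns : 'I_n -> nat)
    (U : forall i, 'M[R]_(\sum_(j < n) Ns j, Ns i))
    (nu : forall i, 'cV[R]_(Ns i) -> R) (w : 'I_n -> R)
    (x : 'cV[R]_(\sum_(j < n) Ns j)) : R :=
  Num.sqrt (\sum_(i < n) w i * (nu i ((U i)^T *m x)) ^+ 2).

Definition level_dists n (Ns : 'I_n -> nat)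
    (U : forall i, 'M[R]_(\sum_(j < n) Ns j, Ns i))
    (nu : forall i, 'cV[R]_(Ns i) -> R) (w : 'I_n -> R)
    (f : 'cV[R]_(\sum_(j < n) Ns j) -> R) (fstar : R)
    (x : 'cV[R]_(\sum_(j < n) Ns j)) : set R :=
  [set r | exists y xs, [/\ f y <= f x, f xs = fstar
                                & r = wnorm U nu w (y - xs)]].

Definition level_radius n (Ns : 'I_n -> nat)
    (U : forall i, 'M[R]_(\sum_(j < n) Ns j, Ns i))
    (nu : forall i, 'cV[R]_(Ns i) -> R) (w : 'I_n -> R)
    (f : 'cV[R]_(\sum_(j < n) Ns j) -> R) (fstar : R)
    (x : 'cV[R]_(\sum_(j < n) Ns j)) : R :=
  sup (level_dists U nu w f fstar x).

Definition rcds_step n (Ns : 'I_n -> nat)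
    (U : forall i, 'M[R]_(\sum_(j < n) Ns j, Ns i))
    (sharp : forall i, 'cV[R]_(Ns i) -> 'cV[R]_(Ns i)) (L : 'I_n -> R)
    (f : 'cV[R]_(\sum_(j < n) Ns j) -> R)
    (x : 'cV[R]_(\sum_(j < n) Ns j)) (i : 'I_n) : 'cV[R]_(\sum_(j < n) Ns j) :=
  x - (L i)^-1 *: (U i *m sharp i ((U i)^T *m grad (f : _ -> R^o) x)).

(* x_k obtained from x_0 along the realized index sequence i_0, ..., i_{k-1} *)
Definition rcds_iter n (Ns : 'I_n -> nat)
    (U : forall i, 'M[R]_(\sum_(j < n) Ns j, Ns i))
    (sharp : forall i, 'cV[R]_(Ns i) -> 'cV[R]_(Ns i)) (L : 'I_n -> R)
    (f : 'cV[R]_(\sum_(j < n) Ns j) -> R)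
    (x0 : 'cV[R]_(\sum_(j < n) Ns j)) (s : seq 'I_n) :=
  foldl (rcds_step U sharp L f) x0 s.

Definition prob_iid n (p : 'I_n -> R) (k : nat) (E : k.-tuple 'I_n -> bool) : R :=
  \sum_(t : k.-tuple 'I_n) (\prod_(i <- t) p i) * (E t)%:R.

End RCDS.

(* Main.v *)
Require Import Defs.
From HB Require Import structures.
From mathcomp Require Import all_boot all_order all_algebra.
From mathcomp Require Import all_classical all_reals all_analysis.
From mathcomp Require Import fingroup perm ring lra.
Import Order.TTheory GRing.Theory Num.Theory.
Import numFieldNormedType.Exports.
Set Implicit Arguments. Unset Strict Implicit. Unset Printing Implicit Defensive.
Local Open Scope classical_set_scope.
Local Open Scope ring_scope.

(** Write [xi = f - fstar] and [c = 2 R^2].  Smoothness along the block [i]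
    bounds the decrease of a step from below by [(<s, t> - |t|^2 / 2) / L_i]
    for every [t], where [s] is the block gradient.  Choosing [t] proportional
    to the block of [x - x^*] and averaging over [i], convexity gives
    [E xi(x_{k+1}) <= xi(x_k) - xi(x_k)^2 / c] on the level set of [x_0].
    Let [theta_k] be the mean of [xi(x_k)] truncated to [0] below [eps].
    Then [theta_{k+1} <= theta_k - theta_k^2 / c], which brings [theta] down to
    [eps] after [c / eps - c / xi(x_0)] steps, and
    [theta_{k+1} <= (1 - eps / c) theta_k], which brings it down to [rho eps]
    after [(c / eps) ln (1 / rho)] more; Markov's inequality concludes, the
    summand [2] paying for rounding both counts up.
    The second bound on [k] implies the first because [xi(x_0) <= c / 4]. *)

(** * Expectations over index sequences as iterated one-step means *)

Definition mean_step (R : realType) (X : Type) n (p : 'I_n -> R)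
    (step : X -> 'I_n -> X) (phi : X -> R) (x : X) : R :=
  \sum_(i < n) p i * phi (step x i).

Lemma big_tuple_cons (R : realType) (T : finType) k (F : k.+1.-tuple T -> R) :
  \sum_(t : k.+1.-tuple T) F t =
  \sum_(i : T) \sum_(t : k.-tuple T) F [tuple of i :: t].
Proof.
rewrite pair_big /=.
rewrite (reindex (fun u : T * k.-tuple T => [tuple of u.1 :: u.2])) //=.
exists (fun t => (thead t, [tuple of behead t])) => [[i t] _|t _] /=.
  by rewrite theadE; congr (_, _); apply: val_inj.
by rewrite [RHS]tuple_eta; apply: val_inj.
Qed.

(** Conditioning on the first index: [foldl] consumes the head of the tuple first, so its mean is
    the outermost one. *)
Lemma sum_tuple_iter_mean_step (R : realType) (X : Type) n (p : 'I_n -> R)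
    (step : X -> 'I_n -> X) (phi : X -> R) k x :
  \sum_(t : k.-tuple 'I_n) (\prod_(i <- t) p i) * phi (foldl step x t)
  = iter k (mean_step p step) phi x.
Proof.
elim: k x => [|k IH] x.
  rewrite (bigD1 [tuple])//= big_nil mul1r big1 ?addr0// => t.
  by case/negP; apply/eqP; rewrite tuple0; apply: val_inj.
rewrite big_tuple_cons iterS; apply: eq_bigr => i _.
rewrite -IH mulr_sumr; apply: eq_bigr => t _.
by rewrite big_cons /= mulrA.
Qed.

(** This is [1 / u k >= 1 / u 0 + k / c] with denominators cleared, so that [u k] may vanish. *)
Lemma sub_sqr_recurrence (R : realType) (u : nat -> R) (c : R) k : 0 < c ->
  (forall j, 0 <= u j) -> 0 < u 0 ->
  (forall j, u j.+1 <= u j - u j ^+ 2 / c) ->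
  u k * (c / u 0 + k%:R) <= c.
Proof.
move=> c0 u_ge0 u00 rec; elim: k => [|k IH].
  by rewrite addr0 mulrC divfK ?gt_eqF.
have := rec k; set a := u k in IH *; set m := c / u 0 + k%:R in IH *.
have m0 : 0 < m by rewrite ltr_wpDr// divr_gt0.
rewrite -natr1 addrA -/m => le.
have a0 : 0 <= a by exact: u_ge0.
have le1 : u k.+1 * c <= a * (c - a).
  by move: le => /(ler_wpM2r (ltW c0)); rewrite mulrBl divfK ?gt_eqF//; lra.
have m1 : 0 <= m + 1 by lra.
rewrite -(ler_pM2r c0) mulrAC; apply: le_trans (ler_wpM2r m1 le1) _.
(* For [a <= c], the bound [a * m <= c] makes the left side at most [c ^+ 2 - a ^+ 2]; for [a > c]
   it is nonpositive. *)
have [ac|/ltW ca] := leP a c.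
  have : 0 <= (c - a * m) * (c - a) by apply: mulr_ge0; lra.
  have := sqr_ge0 a; lra.
apply: (@le_trans _ _ 0); last by rewrite mulr_ge0// ltW.
by rewrite mulr_le0_ge0// mulr_ge0_le0// subr_le0.
Qed.

(** * Concentration for a random iteration that preserves a set [S] *)

Section mean_step.
Context (R : realType) (X : Type) (n : nat) (p : 'I_n -> R).
Context (step : X -> 'I_n -> X) (S : X -> Prop).
Hypothesis p_ge0 : forall i, 0 <= p i.
Hypothesis p_sum : \sum_(i < n) p i = 1.
Hypothesis stepS : forall x i, S x -> S (step x i).

Local Notation T := (mean_step p step).

Lemma iter_mean_step_le k phi psi x : S x ->
  (forall y, S y -> phi y <= psi y) -> iter k T phi x <= iter k T psi x.
Proof.
move=> Sx le; elim: k x Sx => [|k IH] x Sx; first exact: le.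
by apply: ler_sum => i _; apply: ler_wpM2l => //; exact/IH/stepS.
Qed.

Lemma iter_mean_step_affine k (a b : R) phi x :
  iter k T (fun y => a * phi y + b) x = a * iter k T phi x + b.
Proof.
elim: k x => [//|k IH] x; rewrite !iterS /mean_step.
under eq_bigr => i _ do rewrite IH mulrDr mulrCA.
by rewrite big_split /= -mulr_sumr -mulr_suml p_sum mul1r.
Qed.

Lemma iter_mean_step_ge0 k phi x : S x ->
  (forall y, S y -> 0 <= phi y) -> 0 <= iter k T phi x.
Proof.
move=> Sx h; have := iter_mean_step_affine k 0 0 phi x.
by rewrite mul0r addr0 => <-; apply: iter_mean_step_le => // y /h; lra.
Qed.

(* Jensen's inequality enters through [phi^2 >= 2 a phi - a^2], taken at
   [a = iter k T phi x]. *)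
Lemma iter_mean_step_sub_sqr k phi c x : 0 < c -> S x ->
  (forall y, S y -> T phi y <= phi y - phi y ^+ 2 / c) ->
  iter k.+1 T phi x <= iter k T phi x - iter k T phi x ^+ 2 / c.
Proof.
move=> c0 Sx h; set a := iter k T phi x.
have -> : a - a ^+ 2 / c =
    iter k T (fun y => (1 - 2 * a / c) * phi y + a ^+ 2 / c) x.
  by rewrite iter_mean_step_affine -/a; ring.
rewrite iterSr; apply: iter_mean_step_le => // y Sy; apply: le_trans (h y Sy) _.
rewrite -subr_ge0; have -> : (1 - 2 * a / c) * phi y + a ^+ 2 / c -
  (phi y - phi y ^+ 2 / c) = (phi y - a) ^+ 2 / c by ring.
by rewrite divr_ge0 ?sqr_ge0// ltW.
Qed.

Lemma iter_mean_step_scale k phi q x : S x ->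
  (forall y, S y -> T phi y <= q * phi y) ->
  iter k.+1 T phi x <= q * iter k T phi x.
Proof.
move=> Sx h; rewrite -[leRHS]addr0 -iter_mean_step_affine iterSr.
by apply: iter_mean_step_le => // y /h; rewrite addr0.
Qed.

Lemma iter_mean_step_concentration (xi : X -> R) (c eps rho : R) k x :
  S x -> (forall y, S y -> 0 <= xi y) ->
  (forall y i, S y -> xi (step y i) <= xi y) ->
  (forall y, S y -> T xi y <= xi y - xi y ^+ 2 / c) ->
  0 < eps -> eps < xi x -> eps < c -> 0 < rho < 1 ->
  c / eps * (1 + ln rho^-1) + 2 - c / xi x <= k%:R ->
  1 - rho <= iter k T (fun y => (xi y <= eps)%R%:R) x.
Proof.
move=> Sx xi0 xi_step xi_T e0 ex ec /andP[r0 r1] hk.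
have c0 : 0 < c by exact: lt_trans ec.
pose phi y := if eps < xi y then xi y else 0.
have phi0 y : S y -> 0 <= phi y by rewrite /phi; case: ifP => // _; exact: xi0.
have phi_T y : S y -> T phi y <= phi y - phi y ^+ 2 / c.
  move=> Sy; rewrite /phi; have [e_xi|xi_e] := ltP eps (xi y).
    apply: le_trans (xi_T y Sy); apply: ler_sum => i _; apply: ler_wpM2l => //.
    by case: ifP => // _; exact/xi0/stepS.
  (* No step increases [xi], so [phi] stays zero once it vanishes. *)
  rewrite expr0n mul0r subr0 /mean_step big1// => i _.
  by rewrite ltNge (le_trans (xi_step _ _ Sy) xi_e) mulr0.
have phi_T' y : S y -> T phi y <= (1 - eps / c) * phi y.
  move=> Sy; apply: le_trans (phi_T y Sy) _.
  rewrite mulrBl mul1r lerD2l lerN2 mulrAC ler_pM2r ?invr_gt0// expr2.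
  rewrite /phi; case: ifP => [e_xi|_]; last by rewrite !mulr0.
  by rewrite ler_wpM2r ?xi0// ltW.
pose u j := iter j T phi x.
have u0 : u 0 = xi x by rewrite /u /= /phi ex.
have u_ge0 j : 0 <= u j by exact: iter_mean_step_ge0.
pose a := c / eps - c / xi x.
have a0 : 0 <= a.
  rewrite subr_ge0 ler_pM2l// lef_pV2 ?posrE//; first exact: ltW.
  exact: lt_trans ex.
have /andP[ta at1] := truncn_itv a0.
(* An integer in the interval from [a] to [a + 1]: large enough for the first phase, at the cost of
   at most one extra step. *)
set k1 := (Num.truncn a).+1 in at1.
have k1a : k1%:R <= a + 1 by rewrite -natr1; lra.
have l0 : 0 < ln rho^-1 by apply: ln_gt0; rewrite invf_gt1.
have ce0 : 0 < c / eps by exact: divr_gt0.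
have cel : 0 < c / eps * ln rho^-1 by exact: mulr_gt0.
have kk1 : (k1 <= k)%N by rewrite -(ler_nat R); move: k1a hk; rewrite /a; lra.
have uk1 : u k1 <= eps.
  have h : u k1 * (c / u 0 + k1%:R) <= c.
    apply: sub_sqr_recurrence => //; first by rewrite u0; exact: lt_trans ex.
    by move=> j; exact: iter_mean_step_sub_sqr.
  rewrite -(ler_pM2r ce0) [leRHS]mulrC divfK ?gt_eqF//; apply: le_trans h.
  by apply: ler_wpM2l => //; move: at1; rewrite u0 /a; lra.
have q0 : 0 <= 1 - eps / c by rewrite subr_ge0 ler_pdivrMr// mul1r ltW.
have ukj j : u (k1 + j)%N <= (1 - eps / c) ^+ j * eps.
  elim: j => [|j IH]; first by rewrite addn0 mul1r.
  rewrite addnS exprS -mulrA; apply: le_trans (ler_wpM2l q0 IH).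
  exact: iter_mean_step_scale.
have uk : u k <= rho * eps.
  rewrite -(subnKC kk1); apply: le_trans (ukj _) _; rewrite ler_pM2r//.
  set j := (k - k1)%N.
  have -> : rho = expR (- ln rho^-1) by rewrite lnV ?posrE// opprK lnK.
  (* The inequality [1 - z <= expR (- z)] turns the geometric decay into an exponential one. *)
  apply: (@le_trans _ _ (expR (- (eps / c)) ^+ j)).
    by apply: lerXn2r; rewrite ?nnegrE ?expR_ge0 ?expR_ge1Dx.
  rewrite -expRM_natl ler_expR mulrN lerN2.
  have : c / eps * ln rho^-1 <= j%:R.
    by rewrite natrB//; move: k1a hk; rewrite /a; lra.
  have ec0 : 0 < eps / c by exact: divr_gt0.
  move=> /(ler_wpM2r (ltW ec0)); apply: le_trans.
  rewrite [leRHS](_ : _ = ln rho^-1)//; field.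
  by rewrite !gt_eqF.
(* Markov's inequality: the indicator of [xi y <= eps] dominates [1 - phi y / eps], since [phi]
   exceeds [eps] wherever it is nonzero. *)
apply: (@le_trans _ _ (iter k T (fun y => - eps^-1 * phi y + 1) x)).
  by move: uk; rewrite iter_mean_step_affine -/(u k) -ler_pdivrMr//; lra.
apply: iter_mean_step_le => // y Sy; rewrite /phi.
have [xi_e|e_xi] := leP (xi y) eps; first by rewrite mulr0 add0r.
by rewrite mulNr addrC subr_le0 ler_pdivlMl// mulr1 ltW.
Qed.

End mean_step.

(** * Inner products, gradients and the first-order convexity inequality *)

Lemma innerDl (R : realType) m (s s' t : 'cV[R]_m) :
  inner (s + s') t = inner s t + inner s' t.
Proof. by rewrite /inner linearD mulmxDl mxE. Qed.

Lemma innerNl (R : realType) m (s t : 'cV[R]_m) : inner (- s) t = - inner s t.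
Proof. by rewrite /inner linearN mulNmx mxE. Qed.

Lemma innerZr (R : realType) m (a : R) (s t : 'cV[R]_m) :
  inner s (a *: t) = a * inner s t.
Proof. by rewrite /inner -scalemxAr mxE. Qed.

Lemma innerNr (R : realType) m (s t : 'cV[R]_m) : inner s (- t) = - inner s t.
Proof. by rewrite -scaleN1r innerZr mulN1r. Qed.

Lemma inner0r (R : realType) m (s : 'cV[R]_m) : inner s 0 = 0.
Proof. by rewrite /inner mulmx0 mxE. Qed.

Lemma inner_sumr (R : realType) m (I : finType) (s : 'cV[R]_m)
    (t : I -> 'cV[R]_m) : inner s (\sum_i t i) = \sum_i inner s (t i).
Proof. by rewrite /inner mulmx_sumr summxE. Qed.

Lemma inner_mulmxr (R : realType) m k (s : 'cV[R]_m) (A : 'M[R]_(m, k))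
    (t : 'cV[R]_k) : inner s (A *m t) = inner (A^T *m s) t.
Proof. by rewrite /inner trmx_mul trmxK mulmxA. Qed.

Lemma diff_grad (R : realType) N (f : 'cV[R]_N -> R) (x d : 'cV[R]_N) :
  'd (f : _ -> R^o) x d = inner (grad f x) d.
Proof.
rewrite {1}(matrix_sum_delta d) linear_sum /inner mxE; apply: eq_bigr => i _.
by rewrite big_ord1 linearZ !mxE mulrC.
Qed.

Lemma derive_grad (R : realType) N (f : 'cV[R]_N -> R) (x d : 'cV[R]_N) :
  differentiable (f : _ -> R^o) x ->
  is_derive x d (f : _ -> R^o) (inner (grad f x) d).
Proof.
move=> df; apply: DeriveDef; first exact: diff_derivable.
by rewrite deriveE// diff_grad.
Qed.

(** The difference quotients of the restriction at [a] coincide with those of [f] at [x + a *: d]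
    along [d], hence so do their limits. *)
Lemma derive_line (R : realType) N (f : 'cV[R]_N -> R) (x d : 'cV[R]_N)
    (a : R) :
  differentiable (f : _ -> R^o) (x + a *: d) ->
  is_derive a 1 (fun b : R => f (x + b *: d) : R^o)
    (inner (grad f (x + a *: d)) d).
Proof.
move=> /(derive_grad d)[]; rewrite /derivable /derive => dd dE.
have E : (fun h : R => h^-1 *: (((fun b : R => f (x + b *: d) : R^o) \o shift a)
      (h *: 1) - f (x + a *: d) : R^o)) =
    (fun h : R => h^-1 *: (((f : _ -> R^o) \o shift (x + a *: d)) (h *: d)
      - f (x + a *: d))).
  apply/funext => h /=; congr (_ *: (f _ - _)).
  by rewrite [h *: 1]mulr1 scalerDl addrCA.
by split; rewrite /derivable /derive E.
Qed.

(** Convexity bounds the difference quotient along [y - x] by [f y - f x] for [0 < h <= 1] only, so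
    the derivative is read as a limit from the right. *)
Lemma convex_grad_le (R : realType) N (f : 'cV[R]_N -> R) (x y : 'cV[R]_N) :
  convex_fun f -> differentiable (f : _ -> R^o) x ->
  f x + inner (grad f x) (y - x) <= f y.
Proof.
move=> cf df; have [dd <-] := derive_grad (y - x) df.
rewrite addrC -lerBrDr /derive cvg_at_rightE//; apply: limr_le.
  apply: cvgP; apply: cvg_trans dd; apply: cvg_app.
  by move=> A [e e0 Ae]; exists e => // z ze z0; apply: Ae => //; exact/lt0r_neq0.
near=> h.
have h0 : 0 < h by near: h; exact: nbhs_right_gt.
have h1 : h <= 1 by near: h; exact: nbhs_right_le.
rewrite /= [_ *: _]/(_ * _) ler_pdivrMl//.
have := cf y x h; rewrite h1 (ltW h0) => /(_ isT).
have -> : h *: y + (1 - h) *: x = h *: (y - x) + x.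
  by rewrite scalerBl scalerBr scale1r addrAC addrA.
lra.
Unshelve. all: end_near. Qed.

(** * Dual norms and the quadratic upper bound along a block *)

Lemma norm0 (R : realType) m (nu : 'cV[R]_m -> R) : is_norm nu -> nu 0 = 0.
Proof. by case=> _ _ h _; rewrite -(scale0r 0) h normr0 mul0r. Qed.

Lemma inner_le_dual_norm (R : realType) m (nu : 'cV[R]_m -> R) (s t : 'cV[R]_m) :
  is_norm nu ->
  has_ubound [set r | exists t, nu t = 1 /\ r = inner s t] ->
  inner s t <= dual_norm nu s * nu t.
Proof.
move=> nn ub; have [n0 nz nZ _] := nn.
have [/nz->|nt] := eqVneq (nu t) 0; first by rewrite inner0r norm0// mulr0.
have nt0 : 0 < nu t by rewrite lt_def nt n0.
rewrite -ler_pdivrMr// mulrC -innerZr; apply: ub_le_sup => //.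
by exists ((nu t)^-1 *: t); rewrite nZ ger0_norm ?invr_ge0// mulVf.
Qed.

(* A minimizer of the conjugate problem bounds [inner s] on the unit sphere,
   so that the supremum defining [dual_norm] is not a junk value. *)
Lemma dual_norm_ubound (R : realType) m (nu : 'cV[R]_m -> R)
    (s u : 'cV[R]_m) :
  (forall t, - inner s u + 2^-1 * nu u ^+ 2 <= - inner s t + 2^-1 * nu t ^+ 2) ->
  has_ubound [set r | exists t, nu t = 1 /\ r = inner s t].
Proof.
move=> su; exists (inner s u - 2^-1 * nu u ^+ 2 + 2^-1) => _ [t [t1 ->]].
by have := su t; rewrite t1 expr1n mulr1; lra.
Qed.

(** The mean value theorem is applied to [psi], the function [f] on the segment minus its quadratic
    model. The map [sharp] serves to make the dual norms finite suprema. *)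
Lemma block_descent (R : realType) N m (U : 'M[R]_(N, m)) (nu : 'cV[R]_m -> R)
    (f : 'cV[R]_N -> R) (L : R) (sharp : 'cV[R]_m -> 'cV[R]_m) :
  is_norm nu -> (forall x, differentiable (f : _ -> R^o) x) ->
  (forall x t, dual_norm nu (U^T *m (grad f (x + U *m t) - grad f x))
     <= L * nu t) ->
  (forall s t, - inner s (sharp s) + 2^-1 * nu (sharp s) ^+ 2
     <= - inner s t + 2^-1 * nu t ^+ 2) ->
  forall (x : 'cV[R]_N) h, f (x + U *m h)
    <= f x + inner (U^T *m grad f x) h + L / 2 * nu h ^+ 2.
Proof.
move=> nn df Lip shP x h.
pose d := U *m h; pose c0 := inner (grad f x) d.
pose c1 := L / 2 * nu h ^+ 2.
pose psi := fun a : R => f (x + a *: d) - (a * c0 + a ^+ 2 * c1).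
pose dpsi := fun a : R => inner (grad f (x + a *: d)) d - (c0 + 2 * a * c1).
have dp (a : R) : is_derive a 1 (psi : R -> R^o) (dpsi a).
  have dl := derive_line (df (x + a *: d)).
  have di := is_derive_id a (1 : R^o).
  have -> : psi = (fun b : R => f (x + b *: d) : R^o) -
      (c0 \*: id + c1 \*: (id * id : R -> R^o)).
    apply/funext => b; rewrite /psi !fctE /=; congr (_ - _).
    by rewrite ![_ *: _]/(_ * _) expr2 (mulrC b) (mulrC (b * b)).
  apply: (is_derive_eq (is_deriveB dl (is_deriveD (is_deriveZ c0 di)
    (is_deriveZ c1 (is_deriveM di di))))).
  rewrite /dpsi; congr (_ - _).
  by change (c0 * 1 + c1 * (a * 1 + a * 1) = c0 + 2 * a * c1); ring.
have [|c c01 psiE] := @MVT R psi dpsi 0 1 ltr01 (fun a _ => dp a).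
  by apply: derivable_within_continuous => a _; case: (dp a).
have dle : dpsi c <= 0.
  have cp : 0 < c by move: c01; rewrite in_itv /= => /andP[].
  (* The displacement [c *: h] changes the slope along [h] by at most [L * c * nu h ^+ 2], which is
     [2 * c * c1]. *)
  have := inner_le_dual_norm h nn (dual_norm_ubound
    (shP (U^T *m (grad f (x + U *m (c *: h)) - grad f x)))).
  have := Lip x (c *: h); case: nn => n0 _ nZ _.
  rewrite nZ (gtr0_norm cp) -scalemxAr => /(ler_wpM2r (n0 h)) A B.
  have {A B} := le_trans B A.
  rewrite -inner_mulmxr innerDl innerNl.
  have aux (b b0 v : R) : b - b0 <= L * (c * v) * v ->
    b - (b0 + 2 * c * (L / 2 * v ^+ 2)) <= 0 by lra.
  exact: aux.
move: psiE; rewrite /psi scale1r scale0r addr0 -inner_mulmxr.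
have aux (b b0 e : R) : e <= 0 -> b - (1 * c0 + 1 ^+ 2 * c1) -
  (b0 - (0 * c0 + 0 ^+ 2 * c1)) = e * (1 - 0) -> b <= b0 + c0 + c1 by lra.
exact: aux.
Qed.

(** * Block decomposition and the finite Jensen inequality *)

Lemma perm_blocks_resolution (R : realType) n (Ns : 'I_n -> nat)
    (U : forall i : 'I_n, 'M[R]_(\sum_(j < n) Ns j, Ns i)) :
  is_perm_mx (\mxrow_(i < n) U i) -> \sum_i U i *m (U i)^T = 1%:M.
Proof.
move=> /is_perm_mxP[s Us]; rewrite -mul_mxrow_mxcol -tr_mxrow Us.
by rewrite tr_perm_mx -perm_mxM mulgV perm_mx1.
Qed.

(** The weights are left unnormalized because the induction passes to the tail of the list, whose
    weights have a smaller sum. *)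
Lemma convex_fun_sum (R : realType) N (f : 'cV[R]_N -> R) (I : eqType)
    (r : seq I) (p : I -> R) (x : I -> 'cV[R]_N) :
  convex_fun f -> (forall i, 0 < p i) -> r != [::] ->
  f ((\sum_(i <- r) p i)^-1 *: \sum_(i <- r) p i *: x i) * \sum_(i <- r) p i
  <= \sum_(i <- r) p i * f (x i).
Proof.
move=> cf p0; elim: r => // i [|j r] IH _.
  by rewrite !big_seq1 scalerA mulVf ?gt_eqF// scale1r mulrC.
move: IH => /(_ isT); rewrite 3!(big_cons _ _ i).
set q := \sum_(_ <- _ :: _) p _; set y := \sum_(_ <- _ :: _) _ *: _.
set F := \sum_(_ <- _ :: _) _ * f _ => IH.
have q0 : 0 < q by rewrite /q big_cons ltr_wpDr// sumr_ge0// => l _; exact: ltW.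
have pi0 := p0 i; have pq0 : 0 < p i + q by exact: addr_gt0.
have := cf (x i) (q^-1 *: y) (p i / (p i + q)).
have -> : 0 <= p i / (p i + q) <= 1.
  by rewrite (divr_ge0 (ltW pi0) (ltW pq0)) ler_pdivrMr// mul1r lerDl ltW.
move=> /(_ isT).
have -> : 1 - p i / (p i + q) = q / (p i + q) by field; rewrite gt_eqF.
have -> : p i / (p i + q) *: x i + q / (p i + q) *: (q^-1 *: y) =
    (p i + q)^-1 *: (p i *: x i + y).
  rewrite scalerDr !scalerA [_^-1 * p i]mulrC; congr (_ + _ *: _).
  by field; rewrite !gt_eqF.
move=> /(ler_wpM2r (ltW pq0)) /le_trans; apply.
set A := f (x i); set B := f (q^-1 *: y).
have -> : (p i / (p i + q) * A + q / (p i + q) * B) * (p i + q) = p i * A + B * q.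
  by field; rewrite gt_eqF.
by rewrite lerD2l.
Qed.

(** * Descent of one random coordinate step *)

Section coordinate_descent.
Context (R : realType) (n : nat) (Ns : 'I_n -> nat).
Context (U : forall i : 'I_n, 'M[R]_(\sum_(j < n) Ns j, Ns i)).
Context (nu : forall i : 'I_n, 'cV[R]_(Ns i) -> R).
Context (f : 'cV[R]_(\sum_(j < n) Ns j) -> R).
Context (L p : 'I_n -> R) (fstar : R).
Context (sharp : forall i : 'I_n, 'cV[R]_(Ns i) -> 'cV[R]_(Ns i)).
Arguments nu : clear implicits.
Arguments sharp : clear implicits.
Hypothesis U_perm : is_perm_mx (\mxrow_(i < n) U i).
Hypothesis nu_norm : forall i, is_norm (nu i).
Hypothesis f_convex : convex_fun f.
Hypothesis f_diff : forall x, differentiable (f : _ -> R^o) x.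
Hypothesis L_gt0 : forall i, 0 < L i.
Hypothesis f_smooth : forall x i (t : 'cV[R]_(Ns i)),
  dual_norm (nu i) ((U i)^T *m (grad f (x + U i *m t) - grad f x))
    <= L i * nu i t.
Hypothesis f_ge : forall x, fstar <= f x.
Hypothesis p_gt0 : forall i, 0 < p i.
Hypothesis p_sum : \sum_(i < n) p i = 1.
Hypothesis sharp_min : forall i (s t : 'cV[R]_(Ns i)),
  - inner s (sharp i s) + 2^-1 * (nu i (sharp i s)) ^+ 2
    <= - inner s t + 2^-1 * (nu i t) ^+ 2.

Local Notation step := (rcds_step U sharp L f).
Local Notation pgrad i x := ((U i)^T *m grad f x).
Local Notation W := (fun i => L i / p i).

Local Notation vec := ('cV[R]_(\sum_(j < n) Ns j)).

Lemma block_sum (x : vec) : x = \sum_i U i *m ((U i)^T *m x).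
Proof.
rewrite -{1}(mul1mx x) -(perm_blocks_resolution U_perm) mulmx_suml.
by apply: eq_bigr => i _; rewrite mulmxA.
Qed.

Lemma wnorm_sqr x : wnorm U nu W x ^+ 2 =
  \sum_i L i / p i * nu i ((U i)^T *m x) ^+ 2.
Proof.
rewrite sqr_sqrtr// sumr_ge0// => i _.
by rewrite mulr_ge0 ?sqr_ge0// divr_ge0// ltW.
Qed.

(** The quadratic bound at the actual step is the case [t = sharp i s]; minimality of [sharp]
    extends it to every [t]. *)
Lemma step_descent x i (t : 'cV[R]_(Ns i)) :
  f (step x i) <= f x - (L i)^-1 * (inner (pgrad i x) t - 2^-1 * nu i t ^+ 2).
Proof.
rewrite /rcds_step; set s := pgrad i x.
have := block_descent (nu_norm i) f_diff (f_smooth^~ i) (@sharp_min i) x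
  (- (L i)^-1 *: sharp i s).
have [n0 _ nZ _] := nu_norm i.
rewrite -/s innerZr nZ normrN gtr0_norm ?invr_gt0// scaleNr mulmxN -scalemxAr.
move=> /le_trans; apply.
have Li := L_gt0 i; have Vi : 0 < (L i)^-1 by rewrite invr_gt0.
have -> : L i / 2 * ((L i)^-1 * nu i (sharp i s)) ^+ 2 =
  (L i)^-1 * (2^-1 * nu i (sharp i s) ^+ 2) by field; rewrite gt_eqF.
have := ler_wpM2l (ltW Vi) (sharp_min s t).
lra.
Qed.

Lemma step_le x i : f (step x i) <= f x.
Proof.
have := step_descent x (0 : 'cV_(Ns i)).
by rewrite inner0r norm0// expr0n mulr0 subr0 mulr0 subr0.
Qed.

Lemma pgrad_min_le0 x i (h : 'cV[R]_(Ns i)) :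
  f x = fstar -> inner (pgrad i x) h <= 0.
Proof.
move=> fx; rewrite leNgt; apply/negP; set a := inner _ _ => a0.
pose v := nu i h ^+ 2; have v0 : 0 <= v by exact: sqr_ge0.
have [_ _ nZ _] := nu_norm i.
(* If [a > 0], this test vector forces a step below [fstar]; the [+ 1] keeps the denominator
   positive when [v = 0]. *)
have := le_trans (f_ge _) (step_descent x ((a / (v + 1)) *: h)).
rewrite innerZr -/a nZ fx lerBrDl gerDr pmulr_rle0 ?invr_gt0//.
rewrite exprMn -normrX ger0_norm ?sqr_ge0// -/v expr_div_n.
have v1 : 0 < v + 1 by lra.
have -> : a / (v + 1) * a - 2^-1 * (a ^+ 2 / (v + 1) ^+ 2 * v) =
  (a ^+ 2 / (v + 1) ^+ 2) * (2^-1 * v + 1) by field; rewrite gt_eqF.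
apply/negP; rewrite -ltNge mulr_gt0//; last by lra.
by rewrite divr_gt0// exprn_gt0.
Qed.

(* [x + d] is the convex combination, with weights [p i], of the points
   [x + p_i^{-1} U_i d^(i)]. *)
Lemma gap_le_wnorm x d : f x = fstar ->
  f (x + d) - fstar <= 2^-1 * wnorm U nu W d ^+ 2.
Proof.
move=> fx; pose h i := (p i)^-1 *: ((U i)^T *m d).
have ne : index_enum 'I_n != [::].
  by apply/eqP => e; move: p_sum; rewrite e big_nil => /esym/eqP; rewrite oner_eq0.
have := convex_fun_sum (fun i => x + U i *m h i) f_convex p_gt0 ne.
rewrite p_sum invr1 scale1r mulr1.
have -> : \sum_i p i *: (x + U i *m h i) = x + d.
  rewrite (eq_bigr (fun i => p i *: x + p i *: (U i *m h i))); last first.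
    by move=> i _; rewrite scalerDr.
  rewrite big_split /= -scaler_suml p_sum scale1r; congr (_ + _).
  rewrite [RHS]block_sum; apply: eq_bigr => i _.
  by rewrite /h -scalemxAr scalerA mulfV ?gt_eqF// scale1r.
rewrite lerBlDr => /le_trans; apply.
have -> : 2^-1 * wnorm U nu W d ^+ 2 + fstar =
    \sum_i (p i * (2^-1 * L i / p i ^+ 2 * nu i ((U i)^T *m d) ^+ 2 + fstar)).
  under [RHS]eq_bigr => i _ do rewrite mulrDr.
  rewrite big_split /= -mulr_suml p_sum mul1r; congr (_ + _).
  rewrite wnorm_sqr mulr_sumr; apply: eq_bigr => i _.
  by have := p_gt0 i => pi; field; rewrite gt_eqF.
apply: ler_sum => i _; rewrite ler_pM2l//.
apply: le_trans (block_descent (nu_norm i) f_diff (f_smooth^~ i) (@sharp_min i) _ _) _.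
(* At a minimizer the linear term is nonpositive and only the quadratic one remains. *)
have := pgrad_min_le0 (h i) fx; have [_ _ nZ _] := nu_norm i.
rewrite /h nZ fx gtr0_norm ?invr_gt0// exprMn -exprVn -/(h i).
set a := inner _ _; set b := nu _ _ ^+ 2 => a0.
have -> : L i / 2 * ((p i)^-1 ^+ 2 * b) = 2^-1 * L i / p i ^+ 2 * b.
  by rewrite exprVn; ring.
lra.
Qed.

(* Testing the minimality of [sharp] at [t_i = lam (L_i / p_i) (x - y)^(i)]
   with [lam = 2 (f x - fstar) / c] replaces the Cauchy-Schwarz
   inequality between [wnorm] and its dual. *)
Lemma mean_step_gap x y (c : R) : f y = fstar -> 0 < c ->
  2 * wnorm U nu W (x - y) ^+ 2 <= c ->
  mean_step p step (fun z => f z - fstar) x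
    <= (f x - fstar) - (f x - fstar) ^+ 2 / c.
Proof.
move=> fy c0 wc; set xi := f x - fstar; set d := x - y in wc.
have xi0 : 0 <= xi by rewrite subr_ge0.
pose lam := 2 * xi / c; have lam0 : 0 <= lam by rewrite divr_ge0 ?mulr_ge0// ltW.
pose di i := (U i)^T *m d.
pose D i := lam * inner (pgrad i x) (di i)
  - 2^-1 * lam ^+ 2 * (L i / p i * nu i (di i) ^+ 2).
have le1 : mean_step p step (fun z => f z - fstar) x <= \sum_i (p i * xi - D i).
  apply: ler_sum => i _.
  have pi := p_gt0 i; have Li := L_gt0 i; have [_ _ nZ _] := nu_norm i.
  have := step_descent x ((lam * (L i / p i)) *: di i).
  have w0 : 0 <= lam * (L i / p i) by rewrite mulr_ge0// divr_ge0// ltW.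
  rewrite innerZr nZ ger0_norm// => h.
  apply: (@le_trans _ _ (p i * (xi - (L i)^-1 * (lam * (L i / p i) *
    inner (pgrad i x) (di i) - 2^-1 * (lam * (L i / p i) * nu i (di i)) ^+ 2)))).
    by rewrite ler_pM2l// /xi; lra.
  rewrite le_eqVlt; apply/orP; left; apply/eqP; rewrite /D; field.
  by rewrite !gt_eqF.
apply: le_trans le1 _.
rewrite sumrB -mulr_suml p_sum mul1r lerD2l lerN2 sumrB -!mulr_sumr -wnorm_sqr.
have -> : \sum_i inner (pgrad i x) (di i) = inner (grad f x) d.
  rewrite [in RHS](block_sum d) inner_sumr; apply: eq_bigr => i _.
  by rewrite -inner_mulmxr.
have g : xi <= inner (grad f x) d.
  have := convex_grad_le y f_convex (f_diff x).
  by rewrite -opprB -/d innerNr fy /xi; lra.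
(* The mean decrease is at least [lam * xi - lam ^+ 2 * c / 4], that is
   [2 * xi ^+ 2 / c - xi ^+ 2 / c]; this [lam] maximizes it. *)
have := ler_wpM2l lam0 g; have := ler_wpM2l (sqr_ge0 lam) wc.
have -> : lam ^+ 2 * c = 4 * (xi ^+ 2 / c) by rewrite /lam; field; rewrite gt_eqF.
have -> : lam * xi = 2 * (xi ^+ 2 / c) by rewrite /lam; field; rewrite gt_eqF.
lra.
Qed.

End coordinate_descent.

Theorem theorem11 (R : realType) (n : nat) (Ns : 'I_n -> nat)
    (U : forall i : 'I_n, 'M[R]_(\sum_(j < n) Ns j, Ns i))
    (nu : forall i : 'I_n, 'cV[R]_(Ns i) -> R)
    (f : 'cV[R]_(\sum_(j < n) Ns j) -> R)
    (L p : 'I_n -> R) (fstar : R)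
    (sharp : forall i : 'I_n, 'cV[R]_(Ns i) -> 'cV[R]_(Ns i))
    (x0 : 'cV[R]_(\sum_(j < n) Ns j)) (eps rho : R) (k : nat) :
  (* block structure: U = [U_1, ..., U_n] is a column permutation of I_N *)
  is_perm_mx (\mxrow_(i < n) U i) ->
  (forall i, (0 < Ns i)%N) ->
  (* norms on the blocks *)
  (forall i, is_norm (nu i)) ->
  (* f convex, differentiable, with block-Lipschitz gradients *)
  convex_fun f ->
  (forall x, differentiable (f : _ -> R^o) x) ->
  (forall i, 0 < L i) ->
  (forall x i (t : 'cV[R]_(Ns i)),
     dual_norm (nu i) ((U i)^T *m (grad (f : _ -> R^o) (x + U i *m t)
                                   - grad (f : _ -> R^o) x))
       <= L i * nu i t) ->
  (* f attains its minimum f^* *)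
  (exists xs, f xs = fstar) -> (forall x, fstar <= f x) ->
  (* p is a probability vector with positive entries *)
  (forall i, 0 < p i) -> \sum_(i < n) p i = 1 ->
  (* s^# is an optimal solution of min_t { -<s,t> + 1/2 ||t||_(i)^2 } *)
  (forall i (s t : 'cV[R]_(Ns i)),
     - inner s (sharp i s) + 2^-1 * (nu i (sharp i s)) ^+ 2
       <= - inner s t + 2^-1 * (nu i t) ^+ 2) ->
  (* R_{LP^{-1}}(x0) is a finite maximum *)
  has_ubound (level_dists U nu (fun i => L i / p i) f fstar x0) ->
  let R2 := (level_radius U nu (fun i => L i / p i) f fstar x0) ^+ 2 in
  0 < eps -> eps < Num.min (f x0 - fstar) (2 * R2) ->
  0 < rho < 1 ->
  (k%:R >= 2 * R2 / eps * (1 + ln rho^-1) + 2 - 2 * R2 / (f x0 - fstar)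
   \/ k%:R >= 2 * R2 / eps * (1 + ln rho^-1) - 2) ->
  prob_iid p (fun t : k.-tuple 'I_n =>
                f (rcds_iter U sharp L f x0 t) - fstar <= eps)
    >= 1 - rho.
Proof.
move=> U_perm _ nu_norm cf df L0 Lip [xs fxs] fge p0 ps shP ub.
set W := (fun i => L i / p i) in ub *.
move=> R2 e0; rewrite lt_min => /andP[e1 e2] r01 hk.
have wle y : f y <= f x0 -> wnorm U nu W (y - xs) ^+ 2 <= R2.
  move=> fy; have w0 : 0 <= wnorm U nu W (y - xs) by exact: sqrtr_ge0.
  have le : wnorm U nu W (y - xs) <= level_radius U nu W f fstar x0.
    by apply: ub_le_sup => //; exists y, xs.
  by apply: lerXn2r => //; rewrite nnegrE // (le_trans w0).
have xi0 : 0 < f x0 - fstar by exact: lt_trans e1.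
have xi_le : f x0 - fstar <= 2^-1 * R2.
  have := gap_le_wnorm U_perm nu_norm cf df L0 Lip fge p0 ps shP (x0 - xs) fxs.
  rewrite [xs + _]addrC subrK => /le_trans; apply.
  by rewrite ler_pM2l ?invr_gt0//; exact: wle.
have {hk}hk : 2 * R2 / eps * (1 + ln rho^-1) + 2 - 2 * R2 / (f x0 - fstar) <= k%:R.
  (* Hence [2 - 2 * R2 / (f x0 - fstar) <= -2]. *)
  case: hk => // hk; have : 4 <= 2 * R2 / (f x0 - fstar).
    by rewrite ler_pdivlMr//; lra.
  by move: hk; lra.
rewrite /prob_iid /rcds_iter.
rewrite (sum_tuple_iter_mean_step p (rcds_step U sharp L f) (fun y => (f y - fstar <= eps)%R%:R)).
(* The invariant set is the level set of [x0], on which [wle] bounds the distance to [xs]. *)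
apply: (@iter_mean_step_concentration _ _ _ _ _ (fun y => f y <= f x0) _ _ _
  (fun y => f y - fstar) (2 * R2) eps) => //.
- by move=> i; exact: ltW.
- by move=> y i; apply: le_trans; exact: (step_le nu_norm df L0 Lip shP).
- by move=> y _; rewrite subr_ge0.
- by move=> y i _; rewrite lerD2r; exact: (step_le nu_norm df L0 Lip shP).
- move=> y Sy; apply: (mean_step_gap U_perm nu_norm cf df L0 Lip fge p0 ps shP fxs).
    by exact: lt_trans e2.
  by rewrite ler_pM2l//; exact: wle.
Qed.
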